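(* Let $v\ge 4$ be a multiple of $3$. The hypergraph $K_v^{(3)}-I$ admits a decomposition into tight $9$-cycles if and only if $v\ge 9$.
   Context: $K_v^{(3)}$ denotes the complete $3$-uniform hypergraph on $v$ vertices (all $3$-element subsets of the vertex set are edges). For $3\mid v$, $K_v^{(3)}-I$ denotes the hypergraph obtained from $K_v^{(3)}$ by deleting the edges of a $1$-factor $I$, i.e. a set of $v/3$ pairwise disjoint triples covering all vertices (the choice of $I$ is irrelevant up to isomorphism). A (3-uniform tight) $k$-cycle is given by a cyclic sequence $v_1,v_2,\dots,v_k$ of $k$ distinct vertices, its edges being the $k$ triples $\{v_i,v_{i+1},v_{i+2}\}$, $i=1,\dots,k$, with indices taken modulo $k$. A decomposition of a hypergraph $\mathcal H$ into $k$-cycles is a collection of $k$-cycles (sub-hypergraphs of $\mathcal H$) whose edge sets partition the edge set of $\mathcal H$. *)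

(* Defs.v *)
From mathcomp Require Import all_boot.
Set Implicit Arguments. Unset Strict Implicit. Unset Printing Implicit Defensive.

(* A 3-uniform hypergraph on vertex set 'I_v is given by its edge set, a set
   of 3-element subsets of 'I_v. *)

Definition complete3 (v : nat) : {set {set 'I_v}} :=
  [set e : {set 'I_v} | #|e| == 3].

Definition one_factor (v : nat) (I : {set {set 'I_v}}) : Prop :=
  [/\ (forall e, e \in I -> #|e| = 3), trivIset I & cover I = [set: 'I_v]].

Definition complete3_minus (v : nat) (I : {set {set 'I_v}}) : {set {set 'I_v}} :=
  complete3 v :\: I.

(* A tight k-cycle is given by a cyclic sequence c 0, ..., c (k-1) of k distinct
   vertices (c injective); its edges are {c i, c (i+1), c (i+2)}, indices mod k. *)
Definition tight_cycle (k v : nat) (c : {ffun 'I_k -> 'I_v}) : Prop := injective c.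

Definition cycle_edges (k v : nat) (c : {ffun 'I_k -> 'I_v}) : {set {set 'I_v}} :=
  [set [set c i; c (ordS i); c (ordS (ordS i))] | i : 'I_k].

Definition tight_cycle_decomposition (k v : nat) (E : {set {set 'I_v}})
    (C : seq {ffun 'I_k -> 'I_v}) : Prop :=
  [/\ (forall c, c \in C -> tight_cycle c),
      (forall c, c \in C -> cycle_edges c \subset E) &
      (forall e, e \in E -> count (fun c => e \in cycle_edges c) C = 1)].

Definition has_tight_cycle_decomposition (k v : nat) (E : {set {set 'I_v}}) : Prop :=
  exists C : seq {ffun 'I_k -> 'I_v}, tight_cycle_decomposition E C.

(* Main.v *)
(* Call the members of I blocks.  A triple of vertices other than a block meets
   two or three blocks; sort the triples by the set of blocks they meet.  For
   three blocks x, y, z write xyz for the 27 triples meeting all of them, and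
   xy for the 18 triples contained in the union of x and y, blocks excluded.
   Computer search gives 9-cycle decompositions of the following unions:
     xyz;
     xy, xa, ya, xya (that is, v = 9);
     xa, xb, ya, yb, xya, xyb;      the same with xy;      the same with xy, ab.
   By removing a, b from s two at a time they decompose, for every nonempty set
   s of blocks, the union of xy and of all xa, ya, xya with a in s.  Removing
   x, y from a set of blocks then reduces its size by two, the left-over
   classes xab and yab being of the first kind; the induction starts with three
   blocks (second kind) and four blocks (last kind).  *)

Require Import Defs.
From mathcomp Require Import all_boot.
From mathcomp Require Import zify.

Set Implicit Arguments. Unset Strict Implicit. Unset Printing Implicit Defensive.

(** * Sublists of length [k] *)

Fixpoint choose (T : Type) (k : nat) (s : seq T) : seq (seq T) :=
  match k, s with
  | 0, _ => [:: [::]]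
  | _.+1, [::] => [::]
  | j.+1, x :: s' => [seq x :: p | p <- choose j s'] ++ choose k s'
  end.

Lemma choose0 (T : Type) (s : seq T) : choose 0 s = [:: [::]].
Proof. by case: s. Qed.

Lemma choose1 (T : Type) (s : seq T) : choose 1 s = [seq [:: x] | x <- s].
Proof. by elim: s => //= x s <-; case: s. Qed.

Lemma chooseS_cons (T : Type) k (x : T) s :
  choose k.+1 (x :: s) = [seq x :: p | p <- choose k s] ++ choose k.+1 s.
Proof. by []. Qed.

Lemma choose_mem (T : eqType) k (s p : seq T) :
  p \in choose k s -> {subset p <= s} /\ size p = k.
Proof.
elim: s k p => [|x s IHs] [|k] p //=; try by rewrite inE => /eqP->.
rewrite mem_cat => /orP[/mapP[r /IHs[sub sz] ->]|/IHs[sub sz]].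
  split=> [z|/=]; last by rewrite sz.
  by rewrite !inE => /orP[->//|/sub ->]; rewrite orbT.
by split=> // z /sub zs; rewrite inE zs orbT.
Qed.

Lemma choose_uniq (T : eqType) k (s p : seq T) :
  uniq s -> p \in choose k s -> uniq p.
Proof.
elim: s k p => [|x s IHs] [|k] p //=; try by rewrite inE => _ /eqP->.
case/andP=> xs us; rewrite mem_cat => /orP[/mapP[r rc ->]|]; last exact: IHs.
by rewrite /= (IHs _ _ us rc) andbT; apply: contra xs; apply: (choose_mem rc).1.
Qed.

(** Induction on [s]. If the head [x] is in [S], only sublists starting with [x] can match, and
    dropping [x] compares their tails with [S :\ x]; otherwise only sublists avoiding [x] can
    match. *)
Lemma count_choose (T : finType) k (s : seq T) (S : {set T}) : uniq s ->
  count (fun p => [set:: p] == S) (choose k s) =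
    (#|S| == k) && (S \subset [set:: s]).
Proof.
elim: s k S => [|x s IHs] [|k] S //=.
- rewrite set_nil subset0 cards_eq0 addn0 eq_sym; by case: eqP.
- move=> _; rewrite set_nil subset0; apply/esym/eqP; rewrite eqb0.
  by apply/negP => /andP[/eqP cS /eqP S0]; rewrite S0 cards0 in cS.
- move=> _; rewrite set_nil cards_eq0 addn0 eq_sym.
  by case: eqP => // ->; rewrite sub0set.
case/andP=> xs us; rewrite count_cat count_map IHs // set_cons.
have [xS|xS] := boolP (x \in S).
  rewrite [in X in _ + X](_ : S \subset [set:: s] = false) ?andbF ?addn0; last first.
    by apply/negP => /subsetP/(_ x xS); rewrite inE (negPf xs).
  rewrite (@eq_in_count _ _ (fun p => [set:: p] == S :\ x)); last first.
    move=> p /choose_mem[sub _] /=; rewrite set_cons.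
    have xp : x \notin [set:: p] by rewrite inE; apply: contra xs; apply: sub.
    by apply/eqP/eqP => [<-|->]; rewrite ?setU1K ?setD1K.
  by rewrite IHs // (cardsD1 x S) xS subDset.
rewrite (@eq_count _ _ pred0) ?count_pred0; last first.
  move=> p /=; rewrite set_cons; apply/negbTE/eqP => eqS.
  by rewrite -eqS setU11 in xS.
rewrite -subDset (_ : S :\ x = S) //.
by apply/setDidPl; rewrite disjoint_sym disjoints1.
Qed.

(** * Triples of vertices and the finite check of a gadget *)

Lemma card_set3 (T : finType) (x y z : T) :
  uniq [:: x; y; z] -> #|[set x; y; z]| = 3.
Proof.
rewrite /= !inE negb_or andbT => /andP[/andP[xy xz] yz].
by rewrite setUC cardsU1 cards2 !inE xy negb_or eq_sym xz eq_sym yz.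
Qed.

Lemma set3_uniqP (T : finType) (e : {set T}) : #|e| = 3 ->
  exists x y z, e = [set x; y; z] /\ uniq [:: x; y; z].
Proof.
move=> ce; have := enum_uniq e; have : e = [set:: enum e].
  by apply/setP => u; rewrite inE mem_enum.
move: ce; rewrite cardE; case: (enum e) => [|x [|y [|z []]]] // _ eE uE.
exists x, y, z; split=> //; rewrite eE.
by apply/setP => u; rewrite !inE orbA.
Qed.

Lemma card_cycle_edge v (c : {ffun 'I_9 -> 'I_v}) e :
  injective c -> e \in cycle_edges c -> #|e| = 3.
Proof.
move=> ic /imsetP[i _ ->]; apply: card_set3.
rewrite (map_inj_uniq ic [:: i; ordS i; ordS (ordS i)]).
case: i => n ltn; rewrite /= !inE -!val_eqE /=.
by apply/and3P; split=> //; apply/eqP; lia.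
Qed.

(* A word [s] of nine vertex codes stands for the tight cycle
   [s_0, ..., s_8]; the code [3 * g + r] is the [r]-th vertex of block [g]. *)
Definition covers (s w : seq nat) : bool :=
  has (fun t => all (mem w)
    [:: nth 0 s t; nth 0 s (t.+1 %% 9); nth 0 s ((t.+1 %% 9).+1 %% 9)])
    (iota 0 9).

(** Multiplicity is ignored because a triple with two vertices in one block yields a word of block
    indices with a repetition. *)
Definition same_elems (p r : seq nat) : bool := all (mem r) p && all (mem p) r.

(** Here [k] is the number of blocks, [cs] the list of cycles and [fam] the list of block sets whose
    triples are to be decomposed. Equality of the counts also forbids covering any triple outside
    [fam], in particular a block. *)
Definition gadget_ok (k : nat) (cs fam : seq (seq nat)) : bool :=
  let V := iota 0 (3 * k) in
  [&& all (fun s => [&& size s == 9, uniq s & all (gtn (3 * k)) s]) cs,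
      all (all (gtn k)) fam
    & all (fun i => all (fun j => all (fun l => uniq [:: i; j; l] ==>
        (count (covers ^~ [:: i; j; l]) cs ==
         count (same_elems ^~ [:: i %/ 3; j %/ 3; l %/ 3]) fam)) V) V) V].

(* [decomposable I q]: the triples whose set of blocks of [I] is listed in
   [q], counted with multiplicity, can be decomposed into tight 9-cycles. *)
Definition decomposable v (I : {set {set 'I_v}}) (q : seq (seq {set 'I_v})) :=
  exists C : seq {ffun 'I_9 -> 'I_v},
    (forall c, c \in C -> injective c) /\
    (forall e : {set 'I_v}, #|e| = 3 ->
      count (fun c => e \in cycle_edges c) C =
      count (fun p => [set:: p] == pblock I @: e) q).

(** * Transfer of a checked gadget to actual blocks *)

Section Gadget.

Variables (v : nat) (I : {set {set 'I_v}}) (x0 : 'I_v).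
Hypothesis I1 : one_factor I.
Variables (G : seq {set 'I_v}) (cs fam : seq (seq nat)).
Hypotheses (uG : uniq G) (GI : {subset G <= I}).
Hypothesis ok : gadget_ok (size G) cs fam.

(** The vertex with code [n]. The defaults [set0] and [x0] are never reached when [n < 3 * size G],
    every block having three elements. *)
Let f n : 'I_v := nth x0 (enum (nth set0 G (n %/ 3))) (n %% 3).
Let cyc (s : seq nat) : {ffun 'I_9 -> 'I_v} := [ffun t : 'I_9 => f (nth 0 s t)].

Let divG n : n < 3 * size G -> n %/ 3 < size G.
Proof. by lia. Qed.

Let size_enumG g : g < size G -> size (enum (nth set0 G g)) = 3.
Proof.
move=> lt; rewrite -cardE; case: I1 => cI _ _.
by apply: cI; apply: GI; apply: mem_nth.
Qed.

Let pblock_f n : n < 3 * size G -> pblock I (f n) = nth set0 G (n %/ 3).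
Proof.
move=> lt; case: I1 => _ tI _; apply: def_pblock => //.
  by apply: GI; apply/mem_nth/divG.
by rewrite -mem_enum mem_nth // size_enumG ?divG // ltn_mod.
Qed.

Let f_inj : {in gtn (3 * size G) &, injective f}.
Proof.
move=> m n; rewrite !inE => lm ln fmn.
have e1 : m %/ 3 = n %/ 3.
  apply/eqP; rewrite -(nth_uniq set0 _ _ uG) ?divG // -!pblock_f //.
  by rewrite fmn.
have e2 : m %% 3 = n %% 3.
  apply/eqP; rewrite -(nth_uniq x0 _ _ (enum_uniq (nth set0 G (m %/ 3)))).
  - by apply/eqP; move: fmn; rewrite /f -e1.
  - by rewrite size_enumG ?divG // ltn_mod.
  - by rewrite size_enumG ?divG // ltn_mod.
by rewrite (divn_eq m 3) e1 e2 -divn_eq.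
Qed.

Let f_surj x : pblock I x \in G -> exists2 n, n < 3 * size G & x = f n.
Proof.
move=> xG; case: I1 => _ _ cI.
have xB : x \in enum (pblock I x) by rewrite mem_enum mem_pblock cI inE.
have sz : size (enum (pblock I x)) = 3.
  by have := @size_enumG (index (pblock I x) G); rewrite index_mem nth_index // => ->.
have ix : index x (enum (pblock I x)) < 3 by rewrite -[X in _ < X]sz index_mem.
have ig : index (pblock I x) G < size G by rewrite index_mem.
exists (index (pblock I x) G * 3 + index x (enum (pblock I x))); first by lia.
rewrite /f divnMDl // divn_small // addn0 modnMDl modn_small // nth_index //.
by rewrite nth_index.
Qed.

Let cs_ok s : s \in cs -> [/\ size s = 9, uniq s & {subset s <= gtn (3 * size G)}].
Proof.
case/and3P: ok => /allP h _ _ /h /and3P[/eqP-> -> /allP sub].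
by split.
Qed.

Let cyc_inj s : s \in cs -> injective (cyc s).
Proof.
case/cs_ok=> sz us sub t u; rewrite !ffunE => /f_inj.
rewrite !sub ?mem_nth ?sz ?ltn_ord // => /(_ isT isT)/eqP.
by rewrite nth_uniq ?sz ?ltn_ord // => /eqP/val_inj.
Qed.

Let mem_f3 i j l n : i < 3 * size G -> j < 3 * size G -> l < 3 * size G ->
  n < 3 * size G -> (f n \in [set f i; f j; f l]) = (n \in [:: i; j; l]).
Proof. by move=> *; rewrite !inE !(inj_in_eq f_inj) ?inE // orbA. Qed.

Let mem_cycle_edges s i j l : s \in cs ->
  i < 3 * size G -> j < 3 * size G -> l < 3 * size G -> uniq [:: i; j; l] ->
  ([set f i; f j; f l] \in cycle_edges (cyc s)) = covers s [:: i; j; l].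
Proof.
move=> scs li lj ll uijl; have [sz us sub] := cs_ok scs.
have lt t : t < 9 -> nth 0 s t < 3 * size G by move=> ?; apply/sub/mem_nth; rewrite sz.
have in_s (t : 'I_9) : (cyc s t \in [set f i; f j; f l]) = (nth 0 s t \in [:: i; j; l]).
  by rewrite ffunE mem_f3 ?lt.
apply/imsetP/hasP => [[t _ eE]|[t]].
  exists (val t); first by rewrite mem_iota ltn_ord.
  have : all (mem [:: i; j; l])
    [:: nth 0 s t; nth 0 s (ordS t); nth 0 s (ordS (ordS t))]; last by [].
  by apply/and4P; split=> //; rewrite inE -in_s eE !inE eqxx ?orbT.
rewrite mem_iota /= => t9 /and4P[w1 w2 w3 _].
(* [covers] only gives the inclusion of an edge of the cycle in the triple; both have three
   elements, so they coincide. *)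
exists (Ordinal t9) => //; apply/eqP; rewrite eq_sym eqEcard.
rewrite (card_cycle_edge (cyc_inj scs) (imset_f _ _)) //.
rewrite card_set3 ?andbT; last first.
  by rewrite (map_inj_in_uniq (f := f) (s := [:: i; j; l])) // => m n;
    rewrite !inE => /or3P[]/eqP-> /or3P[]/eqP->; apply: f_inj.
by apply/subsetP => u /setUP[/set2P[]|/set1P] ->; rewrite in_s.
Qed.

(** [nth set0 G] is injective on valid indices, so sets of blocks can be compared through their sets
    of indices. *)
Let fam_eq p i j l : p \in fam ->
  i < 3 * size G -> j < 3 * size G -> l < 3 * size G ->
  ([set:: [seq nth set0 G g | g <- p]] == pblock I @: [set f i; f j; f l]) =
  same_elems p [:: i %/ 3; j %/ 3; l %/ 3].
Proof.
move=> pf li lj ll.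
have sub : {subset p <= gtn (size G)}.
  by case/and3P: ok => _ /allP h _; apply/allP/h.
rewrite !imsetU !imset_set1 !pblock_f //.
set r := [:: _; _; _].
have -> : [set nth set0 G (i %/ 3); nth set0 G (j %/ 3); nth set0 G (l %/ 3)]
   = [set:: [seq nth set0 G g | g <- r]].
  by apply/setP => u; rewrite !inE orbA.
have subr : {subset r <= gtn (size G)}.
  by move=> u; rewrite !inE => /or3P[]/eqP->; apply: divG.
have inj : {in gtn (size G) &, injective (nth set0 G)}.
  by move=> a b la lb /eqP; rewrite nth_uniq // => /eqP.
have mm (a b : seq nat) : {subset a <= gtn (size G)} -> {subset b <= gtn (size G)} ->
  ([set:: [seq nth set0 G g | g <- a]] \subset [set:: [seq nth set0 G g | g <- b]]) =
  all (mem b) a.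
  move=> sa sb; apply/subsetP/allP => [h u ua|h u].
    have := h (nth set0 G u); rewrite !inE map_f // => /(_ isT)/mapP[w wb].
    by move/inj => -> //; [apply: sa|apply: sb].
  by rewrite !inE => /mapP[w /h wb ->]; apply: map_f.
by rewrite eqEsubset !mm.
Qed.

Lemma gadget_decomposable :
  decomposable I [seq [seq nth set0 G g | g <- p] | p <- fam].
Proof.
exists [seq cyc s | s <- cs]; split=> [c /mapP[s scs ->]|e ce]; first exact: cyc_inj.
rewrite !count_map.
(* A triple meeting a block outside [G] is counted zero times on both sides; any other triple has
   codes, to which the check applies. *)
have [/subsetP eG|neG] := boolP (pblock I @: e \subset [set:: G]); last first.
  rewrite (@eq_in_count _ _ pred0 cs) ?count_pred0.
    apply/esym; rewrite (@eq_in_count _ _ pred0) ?count_pred0 // => p pf /=.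
    apply/negbTE; apply: contra neG => /eqP<-; apply/subsetP => u; rewrite !inE.
    case/mapP=> g gp ->; apply: mem_nth.
    by case/and3P: ok => _ /allP/(_ p pf)/allP/(_ g gp).
  move=> s scs /=; apply/negbTE; apply: contra neG => /imsetP[t _ ->].
  have [sz us sub] := cs_ok scs.
  have h (u : 'I_9) : pblock I (cyc s u) \in G.
    have lt : nth 0 s u < 3 * size G by apply/sub/mem_nth; rewrite sz.
    by rewrite ffunE pblock_f // mem_nth // divG.
  apply/subsetP => B /imsetP[x]; rewrite !inE -orbA.
  by case/or3P=> /eqP-> ->; rewrite h.
have [x [y [z [eE uxyz]]]] := set3_uniqP ce.
have ex w : w \in e -> exists2 n, n < 3 * size G & w = f n.
  by move=> we; apply: f_surj; have := eG _ (imset_f (pblock I) we); rewrite inE.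
have [i li xE] : exists2 n, n < 3 * size G & x = f n by apply: ex; rewrite eE !inE eqxx.
have [j lj yE] : exists2 n, n < 3 * size G & y = f n
  by apply: ex; rewrite eE !inE eqxx orbT.
have [l ll zE] : exists2 n, n < 3 * size G & z = f n
  by apply: ex; rewrite eE !inE eqxx !orbT.
rewrite {}xE {}yE {}zE in eE uxyz; rewrite {}eE.
have uijl : uniq [:: i; j; l] by apply: (map_uniq (f := f)).
rewrite (@eq_in_count _ _ (covers ^~ [:: i; j; l]) cs); last first.
  by move=> s scs /=; apply: mem_cycle_edges.
rewrite (@eq_in_count _ _ (same_elems ^~ [:: i %/ 3; j %/ 3; l %/ 3]) fam); last first.
  by move=> p pf /=; apply: fam_eq.
have mi n : n < 3 * size G -> n \in iota 0 (3 * size G) by rewrite mem_iota.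
case/and3P: ok => _ _ /allP/(_ i (mi _ li))/allP/(_ j (mi _ lj))/allP/(_ l (mi _ ll)).
by move/implyP/(_ uijl)/eqP.
Qed.

End Gadget.

(** * The five gadgets *)

(* [shift] rotates every block; it is an automorphism of the decompositions
   given below as an [orbit3]. *)
Definition shift (n : nat) : nat := n %/ 3 * 3 + n.+1 %% 3.

Definition orbit3 (cs : seq (seq nat)) : seq (seq nat) :=
  cs ++ map (map shift) cs ++ map (map (shift \o shift)) cs.

(** In all five lists the blocks x, y, a, b have codes 0-2, 3-5, 6-8, 9-11. The lists contain 3, 9,
    14, 16 and 18 cycles, for 27, 81, 126, 144 and 162 triples. *)
Definition triple_cycles : seq (seq nat) :=
  [:: [:: 0; 5; 7; 1; 4; 8; 2; 3; 6]; [:: 0; 4; 6; 1; 3; 7; 2; 5; 8];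
      [:: 0; 3; 8; 1; 5; 6; 2; 4; 7]].

Definition triangle_cycles : seq (seq nat) :=
  orbit3 [:: [:: 0; 1; 7; 6; 4; 5; 2; 8; 3]; [:: 0; 1; 8; 7; 3; 4; 2; 6; 5];
             [:: 0; 1; 6; 8; 5; 3; 2; 7; 4]].

(** [shift] turns each of the two words outside [orbit3] into a cyclic rotation of itself, so each
    is listed once. *)
Definition square_cycles : seq (seq nat) :=
  [:: [:: 0; 6; 3; 1; 7; 4; 2; 8; 5]; [:: 0; 5; 10; 1; 3; 11; 2; 4; 9]] ++
  orbit3 [:: [:: 0; 4; 10; 2; 9; 5; 1; 7; 8]; [:: 0; 1; 10; 11; 5; 2; 6; 4; 7];
             [:: 0; 1; 6; 4; 3; 10; 5; 9; 11]; [:: 0; 1; 9; 4; 3; 7; 5; 6; 8]].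

Definition diamond_cycles : seq (seq nat) :=
  [:: 0; 7; 4; 1; 8; 5; 2; 6; 3] ::
  orbit3 [:: [:: 0; 1; 3; 4; 7; 2; 5; 10; 11]; [:: 0; 1; 6; 7; 3; 8; 4; 2; 9];
             [:: 0; 1; 8; 2; 6; 4; 3; 11; 5]; [:: 0; 3; 2; 4; 11; 1; 5; 10; 9];
             [:: 0; 4; 3; 10; 9; 1; 5; 7; 8]].

Definition tetrahedron_cycles : seq (seq nat) :=
  orbit3 [:: [:: 0; 1; 9; 11; 8; 6; 2; 5; 7]; [:: 0; 1; 10; 11; 8; 7; 4; 6; 3];
             [:: 0; 3; 10; 11; 4; 2; 7; 1; 5]; [:: 0; 1; 8; 5; 4; 9; 2; 3; 11];
             [:: 0; 3; 2; 7; 6; 11; 10; 5; 4]; [:: 0; 5; 11; 2; 10; 3; 4; 8; 6]].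

Lemma triple_ok : gadget_ok 3 triple_cycles [:: [:: 0; 1; 2]].
Proof. by vm_compute. Qed.

Lemma triangle_ok : gadget_ok 3 triangle_cycles
  [:: [:: 0; 1]; [:: 0; 2]; [:: 1; 2]; [:: 0; 1; 2]].
Proof. by vm_compute. Qed.

Lemma square_ok : gadget_ok 4 square_cycles
  [:: [:: 0; 2]; [:: 0; 3]; [:: 1; 2]; [:: 1; 3]; [:: 0; 1; 2]; [:: 0; 1; 3]].
Proof. by vm_compute. Qed.

Lemma diamond_ok : gadget_ok 4 diamond_cycles
  [:: [:: 0; 1]; [:: 0; 2]; [:: 0; 3]; [:: 1; 2]; [:: 1; 3]; [:: 0; 1; 2];
      [:: 0; 1; 3]].
Proof. by vm_compute. Qed.

Lemma tetrahedron_ok : gadget_ok 4 tetrahedron_cycles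
  [:: [:: 0; 1]; [:: 0; 2]; [:: 0; 3]; [:: 1; 2]; [:: 1; 3]; [:: 2; 3];
      [:: 0; 1; 2]; [:: 0; 1; 3]].
Proof. by vm_compute. Qed.

(** * Assembly by induction on the number of blocks *)

(* The values of the predicate are made opaque naturals, lest [lia] split on
   each of these booleans. *)
Ltac count_lia :=
  repeat match goal with
    |- context [nat_of_bool ?b] => move: (nat_of_bool b) => ?
  end; lia.

(** Sorts the pairs and triples of blocks: those avoiding [x] and [y], the star of [x] and [y] over
    [s], and the triples with exactly one of [x], [y]. *)
Lemma perm_choose23 (T : eqType) (x y : T) s :
  perm_eq ((choose 2 s ++ choose 3 s) ++
    ([:: x; y] :: [seq [:: x; a] | a <- s] ++ [seq [:: y; a] | a <- s] ++
      [seq [:: x; y; a] | a <- s]) ++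
    [seq x :: p | p <- choose 2 s] ++ [seq y :: p | p <- choose 2 s])
  (choose 2 (x :: y :: s) ++ choose 3 (x :: y :: s)).
Proof.
apply/permP => P; rewrite !chooseS_cons !choose1.
rewrite /= choose0 !map_cat -!map_comp /comp /= !count_cat /= !count_cat.
count_lia.
Qed.

Section Assembly.

Variables (v : nat) (I : {set {set 'I_v}}) (x0 : 'I_v).
Hypothesis I1 : one_factor I.

Implicit Types (s : seq {set 'I_v}) (q : seq (seq {set 'I_v})).

Lemma decomposable_cat q1 q2 :
  decomposable I q1 -> decomposable I q2 -> decomposable I (q1 ++ q2).
Proof.
case=> C1 [i1 d1] [C2 [i2 d2]]; exists (C1 ++ C2); split=> [c|e ce].
  by rewrite mem_cat => /orP[/i1|/i2].
by rewrite !count_cat d1 ?d2.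
Qed.

Lemma decomposable_perm q1 q2 :
  perm_eq q1 q2 -> decomposable I q1 -> decomposable I q2.
Proof.
move=> /permP eq12 [C [iC dC]]; exists C; split=> // e /dC ->; exact: eq12.
Qed.

Lemma triple_decomposable x y a : uniq [:: x; y; a] -> {subset [:: x; y; a] <= I} ->
  decomposable I [:: [:: x; y; a]].
Proof.
move=> uG GI.
exact: (@gadget_decomposable _ _ x0 I1 _ triple_cycles
  [:: [:: 0; 1; 2]] uG GI triple_ok).
Qed.

Lemma triangle_decomposable x y a : uniq [:: x; y; a] -> {subset [:: x; y; a] <= I} ->
  decomposable I [:: [:: x; y]; [:: x; a]; [:: y; a]; [:: x; y; a]].
Proof.
move=> uG GI.
exact: (@gadget_decomposable _ _ x0 I1 _ triangle_cycles
  [:: [:: 0; 1]; [:: 0; 2]; [:: 1; 2]; [:: 0; 1; 2]] uG GI triangle_ok).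
Qed.

Lemma square_decomposable x y a b : uniq [:: x; y; a; b] -> {subset [:: x; y; a; b] <= I} ->
  decomposable I [:: [:: x; a]; [:: x; b]; [:: y; a]; [:: y; b]; [:: x; y; a]; [:: x; y; b]].
Proof.
move=> uG GI.
exact: (@gadget_decomposable _ _ x0 I1 _ square_cycles
  [:: [:: 0; 2]; [:: 0; 3]; [:: 1; 2]; [:: 1; 3]; [:: 0; 1; 2]; [:: 0; 1; 3]] uG GI square_ok).
Qed.

Lemma diamond_decomposable x y a b : uniq [:: x; y; a; b] -> {subset [:: x; y; a; b] <= I} ->
  decomposable I [:: [:: x; y]; [:: x; a]; [:: x; b]; [:: y; a]; [:: y; b]; [:: x; y; a]; [:: x; y; b]].
Proof.
move=> uG GI.
exact: (@gadget_decomposable _ _ x0 I1 _ diamond_cycles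
  [:: [:: 0; 1]; [:: 0; 2]; [:: 0; 3]; [:: 1; 2]; [:: 1; 3]; [:: 0; 1; 2]; [:: 0; 1; 3]] uG GI diamond_ok).
Qed.

Lemma tetrahedron_decomposable x y a b : uniq [:: x; y; a; b] -> {subset [:: x; y; a; b] <= I} ->
  decomposable I [:: [:: x; y]; [:: x; a]; [:: x; b]; [:: y; a]; [:: y; b]; [:: a; b]; [:: x; y; a]; [:: x; y; b]].
Proof.
move=> uG GI.
exact: (@gadget_decomposable _ _ x0 I1 _ tetrahedron_cycles
  [:: [:: 0; 1]; [:: 0; 2]; [:: 0; 3]; [:: 1; 2]; [:: 1; 3]; [:: 2; 3]; [:: 0; 1; 2]; [:: 0; 1; 3]] uG GI tetrahedron_ok).
Qed.

Lemma decomposable_triples q :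
  (forall p, p \in q -> [/\ size p = 3, uniq p & {subset p <= I}]) ->
  decomposable I q.
Proof.
elim: q => [|p q IHq] h; first by exists [::].
rewrite -cat1s; apply: decomposable_cat; last first.
  by apply: IHq => r rq; apply: h; rewrite inE rq orbT.
have [|sz up pI] := h p; first exact: mem_head.
case: p sz up pI {h} => [|a [|b [|c []]]] // _ up pI.
exact: triple_decomposable.
Qed.

(* The pairs [xa], [ya] and triples [xya] for [a] in [s] are handled two
   elements of [s] at a time; the pair [xy] is absorbed by the last step. *)
Lemma star_decomposable x y s : 0 < size s -> uniq (x :: y :: s) ->
  {subset x :: y :: s <= I} ->
  decomposable I ([:: x; y] :: [seq [:: x; a] | a <- s] ++
    [seq [:: y; a] | a <- s] ++ [seq [:: x; y; a] | a <- s]).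
Proof.
elim/ltn_ind: {s}(size s) {-2}s (erefl (size s)) => n IHn s.
case: s => [|a [|b [|c s]]] szs // n0 us sI.
- exact: (triangle_decomposable us sI).
- exact: (diamond_decomposable us sI).
set s' := c :: s.
have perm_xyab : perm_eq ([:: x; y; a; b] ++ s') (x :: y :: [:: a, b & s']) by [].
have := us; rewrite -(perm_uniq perm_xyab) cat_uniq => /and3P[uxyab _ _].
have us' : uniq (x :: y :: s').
  apply: subseq_uniq us; rewrite /= !eqxx.
  exact: (@suffix_subseq _ [:: a; b] s').
have sI' : {subset x :: y :: s' <= I}.
  move=> z zs; apply: sI; rewrite !inE in zs *.
  by case/or4P: zs => ->; rewrite ?orbT.
have dxyab : {subset [:: x; y; a; b] <= I}.
  by move=> z zs; apply: sI; rewrite -(perm_mem perm_xyab) mem_cat zs.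
have lt : size s' < n by rewrite /s' /= in szs *; lia.
have ds' := IHn _ lt s' erefl isT us' sI'.
apply: decomposable_perm
  (decomposable_cat (square_decomposable uxyab dxyab) ds').
apply/permP => P; rewrite /s' /= !(count_cat, map_cons) /= !count_cat /=; count_lia.
Qed.

Lemma choose23_decomposable s : 2 < size s -> uniq s -> {subset s <= I} ->
  decomposable I (choose 2 s ++ choose 3 s).
Proof.
elim/ltn_ind: {s}(size s) {-2}s (erefl (size s)) => n IHn s.
case: s => [|x [|y [|a [|b [|c s]]]]] szs // _ us sI.
- exact: (triangle_decomposable us sI).
(* With four blocks, the tetrahedron gadget takes all pairs but only the triples xya and xyb; these
   two triples are left. *)
- have d2 : decomposable I [:: [:: x; a; b]; [:: y; a; b]].
    apply: decomposable_triples => p; rewrite !inE => /orP[]/eqP->; split=> //.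
    + by move: us; rewrite /= !inE !negb_or => /and4P[/and3P[_ -> ->] _ -> _].
    + by move=> z zs; apply: sI; rewrite !inE in zs *; case/or3P: zs => ->; rewrite ?orbT.
    + by case/andP: us.
    by move=> z zs; apply: sI; rewrite inE zs orbT.
  apply: decomposable_perm
    (decomposable_cat (tetrahedron_decomposable us sI) d2).
  by apply/permP => P /=; count_lia.
(* At least three blocks remain in [s'], so the induction hypothesis applies. *)
move: us sI; set s' := [:: a, b, c & s] => us sI.
have us' : uniq s' by case/and3P: us.
have sI' : {subset s' <= I} by move=> z zs; apply: sI; rewrite 2!in_cons zs !orbT.
have lt : size s' < n by rewrite /s' /= in szs *; lia.
have ds' := IHn _ lt s' erefl isT us' sI'.
have dxy := @star_decomposable x y s' isT us sI.
have d3 u : u \in [:: x; y] -> decomposable I [seq u :: p | p <- choose 2 s'].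
  move=> uxy; apply: decomposable_triples => p /mapP[r rc ->].
  have [sub sz] := choose_mem rc.
  have us1 : u \notin s'.
    move: us uxy; rewrite /= !inE negb_or => /andP[/andP[_ xs] /andP[ys _]].
    by case/orP=> /eqP->.
  split=> [/=|/=|z]; first by rewrite sz.
    by rewrite (choose_uniq us' rc) andbT; apply: contra us1; apply: sub.
  rewrite inE => /orP[/eqP->|/sub /sI' //]; apply: sI.
  by move: uxy; rewrite !in_cons orbF => /orP[]->; rewrite ?orbT.
apply: decomposable_perm (decomposable_cat ds' (decomposable_cat dxy
  (decomposable_cat (d3 x _) (d3 y _)))); rewrite ?inE ?eqxx ?orbT //.
exact: perm_choose23.
Qed.

(** * From classes of triples back to the hypergraph *)

Lemma card_one_factor : #|I| * 3 = v.
Proof.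
case: I1 => cI tI cov.
rewrite -[v in RHS]card_ord -cardsT -cov; apply/esym/card_uniform_partition => //.
apply/and3P; split=> //; apply/negP => /cI; by rewrite cards0.
Qed.

(** A triple meets a single block exactly when it is a block, so the edges to decompose are the
    triples meeting two or three blocks. *)
Lemma complete3_minus_decomposition : 9 <= v ->
  has_tight_cycle_decomposition 9 (complete3_minus I).
Proof.
move=> v9; have cI3 := card_one_factor; case: (I1) => cI tI cov.
have : decomposable I (choose 2 (enum I) ++ choose 3 (enum I)).
  apply: choose23_decomposable; rewrite ?enum_uniq //; last by move=> z; rewrite mem_enum.
  by rewrite -cardE -(@ltn_pmul2r 3) // cI3 (leq_trans _ v9).
have setI : [set:: enum I] = I by apply/setP => u; rewrite inE mem_enum.
case=> C [iC dC].
have {}dC (e : {set 'I_v}) : #|e| = 3 ->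
    count (fun c => e \in cycle_edges c) C = (1 < #|pblock I @: e| < 4).
  move=> ce; rewrite dC // count_cat !count_choose ?enum_uniq // setI.
  rewrite (_ : _ @: e \subset I) ?andbT; first by lia.
  by apply/subsetP => B /imsetP[x _ ->]; rewrite pblock_mem // cov inE.
have le (e : {set 'I_v}) : #|e| = 3 -> #|pblock I @: e| < 4.
  by move=> ce; rewrite ltnS -ce leq_imset_card.
exists C; split=> // [c cC|e].
  apply/subsetP => e ec; have ce := card_cycle_edge (iC _ cC) ec.
  rewrite !inE ce eqxx andbT; apply/negP => eI.
  have : 0 < count (fun c => e \in cycle_edges c) C by rewrite -has_count; apply/hasP; exists c.
  (* A block meets only itself, so no cycle of [C] can cover it. *)
  rewrite dC // (_ : _ @: e = [set e]) ?cards1 //.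
  have [x xe] : exists x, x \in e by apply/card_gt0P; rewrite ce.
  apply/setP => B; rewrite inE; apply/imsetP/eqP => [[y ye ->]|->].
    exact: def_pblock.
  by exists x => //; rewrite (def_pblock tI eI xe).
rewrite !inE => /andP[eI /eqP ce]; rewrite dC // le // andbT.
have [x xe] : exists x, x \in e by apply/card_gt0P; rewrite ce.
case: ltnP => // card1; case/negP: eI.
(* If [e] meets one block only, it lies inside that block, and both have size three. *)
suff -> : e = pblock I x by rewrite pblock_mem // cov inE.
apply/eqP; rewrite eqEcard ce cI ?pblock_mem ?cov ?inE // andbT.
apply/subsetP => y ye.
have /card_le1_eqP h := card1.
by rewrite (h (pblock I y) (pblock I x)) ?imset_f // mem_pblock cov inE.
Qed.

End Assembly.

Theorem theorem3 (v : nat) (I : {set {set 'I_v}}) :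
  4 <= v -> 3 %| v -> one_factor I ->
  (has_tight_cycle_decomposition 9 (complete3_minus I) <-> 9 <= v).
Proof.
move=> v4 v3 I1; split; last first.
  (* The vertex 0 serves as the default [x0]. *)
  by move=> v9; apply: complete3_minus_decomposition => //; exists 0; lia.
case=> C [iC _ dC]; rewrite leqNgt; apply/negP => v9.
(* A cycle needs nine distinct vertices, so for [v < 9] the list [C] is empty and every triple must
   lie in [I]. *)
case: C => [|c C] in iC dC *; last first.
  have := leq_card _ (iC c (mem_head _ _)); rewrite !card_ord; lia.
have sub : complete3 v \subset I.
  apply/subsetP => e eK; apply/negPn/negP => eI.
  by have := dC e; rewrite inE eI eK => /(_ isT).
(* The only multiple of 3 from 4 to 8 is 6, where there are 20 triples but only two blocks. *)
have := subset_leq_card sub.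
rewrite card_draws card_ord.
have v6 : v = 6 by lia.
have := card_one_factor I1.
by move: #|I| => n; rewrite v6; case: n => [|[|[]]].
Qed.
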